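(* Let $G$ be strongly regular with parameters $(v,k,\lambda,\mu)$, where $k\ne\mu$, and let $\Gamma$ be a finite abelian group with invariant factors $d_1\mid\cdots\mid d_r$. The following necessary conditions hold. (a) If $G$ admits an affinely generating $\Gamma$-magic map, then $d_r=\exp(\Gamma)\mid k-\mu$. (b) If $r\ge2$ and $G$ admits a generating $\Gamma$-magic map, then $d_{r-1}\mid k-\mu$. In particular, if $|\Gamma|=v$ and $G$ admits a $\Gamma$-distance magic labeling, then $\exp(\Gamma)\mid k-\mu$.
   Context: A strongly regular graph with parameters $(v,k,\lambda,\mu)$ is a finite simple $k$-regular graph on $v$ vertices in which every two adjacent vertices have exactly $\lambda$ common neighbors and every two distinct nonadjacent vertices have exactly $\mu$ common neighbors. The invariant factors of a finite abelian group $\Gamma$ are the integers $d_1\mid\cdots\mid d_r$, all $>1$ (with $r=1$, $d_1=1$ for the trivial group), such that $\Gamma\cong\mathbb Z/d_1\mathbb Z\oplus\cdots\oplus\mathbb Z/d_r\mathbb Z$; $\exp(\Gamma)$ is the exponent of $\Gamma$. A map $f\colon V(G)\to\Gamma$ is a $\Gamma$-magic map if there is $\gamma\in\Gamma$ with $\sum_{u\in N_G(x)}f(u)=\gamma$ for every $x\in V(G)$, where $N_G(x)$ is the open neighborhood. It is generating if its labels generate $\Gamma$, and affinely generating if $\langle f(x)-f(y)\mid x,y\in V(G)\rangle=\Gamma$. A $\Gamma$-distance magic labeling is a bijective $\Gamma$-magic map. *)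

(* Defs.v *)
From mathcomp Require Import all_boot all_order all_fingroup all_algebra all_solvable.

Set Implicit Arguments.
Unset Strict Implicit.
Unset Printing Implicit Defensive.

Import GRing.Theory.
Local Open Scope ring_scope.

Record strongly_regular (T : finType) (e : rel T) (v k lambda mu : nat) : Prop :=
  StronglyRegular {
    srg_sym : symmetric e;
    srg_irrefl : irreflexive e;
    srg_card : #|T| = v;
    srg_deg : forall x, #|[set u | e x u]| = k;
    srg_adj : forall x y, e x y -> #|[set u | e x u && e y u]| = lambda;
    srg_nonadj : forall x y, x != y -> ~~ e x y ->
      #|[set u | e x u && e y u]| = mu
  }.

(* [Zp n] is the cyclic group of order [n] for every [n >= 1]: for [n = 1] it is
   the trivial subgroup of ['Z_1], although ['Z_1] itself has two elements.
   [setXn] is the external direct product of its factors. *)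
Definition invariant_factors (Gamma : finZmodType) (d : seq nat) : Prop :=
  [/\ all (fun n => 1 < n)%N d \/ d = [:: 1%N],
      (d != [::]),
      sorted dvdn d &
      [set: Gamma] \isog setXn (fun i : 'I_(size d) => Zp (nth 0%N d i))].

Definition magic_map (T : finType) (e : rel T) (Gamma : finZmodType)
    (f : T -> Gamma) : Prop :=
  exists gamma : Gamma, forall x : T, \sum_(u | e x u) f u = gamma.

(* The group law of a [finZmodType] is its addition, so [<<A>>] is the additive
   subgroup generated by [A]. *)
Definition generating (T : finType) (Gamma : finZmodType) (f : T -> Gamma) : Prop :=
  <<[set f x | x : T]>>%g = [set: Gamma].

Definition affinely_generating (T : finType) (Gamma : finZmodType)
    (f : T -> Gamma) : Prop :=
  <<[set f x - f y | x : T, y : T]>>%g = [set: Gamma].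

Definition distance_magic_labeling (T : finType) (e : rel T)
    (Gamma : finZmodType) (f : T -> Gamma) : Prop :=
  bijective f /\ magic_map e f.

(* Main.v *)
(* With A the adjacency matrix, A^2 = k I + lambda A + mu (J - I - A). Applying
   both sides to a magic map f, for which A f is constant, shows that
   (k - mu) f(x) does not depend on x. Hence k - mu kills the subgroup generated
   by the differences of labels, and if the labels generate Gamma, then
   (k - mu) Gamma is generated by the single element (k - mu) f(x). *)
Require Import Defs.
From mathcomp Require Import all_boot all_order all_fingroup all_algebra all_solvable.

Set Implicit Arguments.
Unset Strict Implicit.

Import GRing.Theory.
Local Open Scope ring_scope.

(** * Walks of length two and magic maps *)

Section MagicMaps.

Variables (T : finType) (e : rel T) (v k lambda mu : nat).
Hypothesis srgG : strongly_regular e v k lambda mu.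

Lemma card_common_neighbors x w :
  #|[set u | e x u && e u w]| =
    if w == x then k else if e x w then lambda else mu.
Proof.
have -> : [set u | e x u && e u w] = [set u | e x u && e w u].
  by apply/setP=> u; rewrite !inE (srg_sym srgG u).
have [->|neq_wx] := eqVneq w x.
  by rewrite -(srg_deg srgG x); apply: eq_card => u; rewrite !inE andbb.
case: ifPn => [|nexw]; first exact: (srg_adj srgG).
by apply: (srg_nonadj srgG) => //; rewrite eq_sym.
Qed.

Variables (Gamma : zmodType) (f : T -> Gamma).

(** This is the identity for A^2 applied to an arbitrary [f]: after swapping the sums, the
    coefficient of [f w] counts the walks of length two from [x] to [w]. *)
Lemma sum_distance_two x :
  \sum_(u | e x u) \sum_(w | e u w) f w =
    f x *+ k + \sum_(w | e x w) f w *+ lambda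
    + (\sum_w f w - f x - \sum_(w | e x w) f w) *+ mu.
Proof.
rewrite (exchange_big_dep predT) //=.
under [LHS]eq_bigr => w _ do rewrite sumr_const.
transitivity (\sum_w f w *+ #|[set u | e x u && e u w]|).
  by apply: eq_bigr => w _; congr (_ *+ _); apply: eq_card => u; rewrite !inE.
under [LHS]eq_bigr => w _ do rewrite card_common_neighbors.
rewrite (bigD1 x) //= eqxx -addrA; congr (_ + _).
rewrite (bigID (e x)) /=.
have adjE w : (w != x) && e x w = e x w.
  by case: (eqVneq w x) => [->|//]; rewrite (srg_irrefl srgG).
rewrite (eq_bigl _ _ adjE); congr (_ + _).
  by apply: eq_bigr => w exw; rewrite -adjE in exw; case/andP: exw => /negPf-> ->.
rewrite [\sum_w f w](bigD1 x) //= (addrC (f x)) addrK.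
rewrite [in RHS](bigID (e x)) /= (eq_bigl _ _ adjE) (addrC (\sum_(w | e x w) _)) addrK.
by rewrite -sumrMnl; apply: eq_bigr => w /andP[/negPf-> /negPf->].
Qed.

End MagicMaps.

Lemma magic_map_scaled_const (T : finType) (e : rel T) (v k lambda mu : nat)
    (Gamma : finZmodType) (f : T -> Gamma) :
    strongly_regular e v k lambda mu -> magic_map e f ->
  exists c, forall x, f x *+ `|k%:Z - mu%:Z|%N = c.
Proof.
move=> srgG [g fg].
(* With A f = g, the formula for A^2 f reads k g = k f(x) + lambda g + mu (sum f - f(x) - g);
   solving for (k - mu) f(x) gives [c]. *)
pose c := g *+ k - g *+ lambda - (\sum_w f w - g) *+ mu.
suff fc x : f x *~ (k%:Z - mu%:Z) = c.
  (* Passing to the absolute value flips the sign of the constant when k < mu. *)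
  exists (if 0 <= k%:Z - mu%:Z then c else - c) => x; rewrite -(fc x).
  by case: (k%:Z - mu%:Z) => n //=; rewrite NegzE mulrNz opprK.
have := sum_distance_two srgG f x; rewrite fg.
under eq_bigr => u _ do rewrite fg.
have -> : \sum_(u | e x u) g = g *+ k.
  by rewrite sumr_const -(srg_deg srgG x); congr (_ *+ _); apply: eq_card => u;
    rewrite !inE.
rewrite /c mulrzBr -!pmulrn => ->.
rewrite [\sum_w f w - f x - g]addrAC [(_ - f x) *+ mu]mulrnBl.
by rewrite sumrMnl fg (addrAC (f x *+ k)) addrK addrA addrAC addrK.
Qed.

(** * Powers in abelian groups *)

Local Open Scope group_scope.

(** In an abelian group the m-th power map is a homomorphism, so the preimage of [K] is a subgroup;
    it contains [S]. *)
Lemma abelian_gen_expg (gT : finGroupType) (S : {set gT}) (K : {group gT}) m :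
    abelian <<S>> -> {in S, forall s, s ^+ m \in K} ->
  {in <<S>>, forall x, x ^+ m \in K}.
Proof.
move=> abS SK; have gP : group_set [set x in <<S>> | x ^+ m \in K].
  apply/group_setP; split=> [|x y]; first by rewrite inE !group1 expg1n group1.
  rewrite !inE => /andP[Sx Kx] /andP[Sy Ky].
  by rewrite groupM //= expgMn ?groupM //; apply: (centsP abS).
have : <<S>> \subset Group gP.
  rewrite gen_subG; apply/subsetP=> s Ss.
  by rewrite inE mem_gen //=; apply: SK.
by move/subsetP=> sSg x /sSg; rewrite inE => /andP[].
Qed.

(** Any [s] in [S] serves as [y], and [y = 1] if [S] is empty. The generator is kept as an m-th
    power so that its coordinates in a product of cyclic groups are multiples of [m]. *)
Lemma abelian_gen_expg_cycle (gT : finGroupType) (S : {set gT}) m c :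
    abelian <<S>> -> {in S, forall s, s ^+ m = c} ->
  exists2 y, y \in <<S>> & {in <<S>>, forall x, x ^+ m \in <[y ^+ m]>}.
Proof.
move=> abS Sc; have [S0|[s Ss]] := set_0Vmem S.
  by exists 1 => // x; rewrite S0 gen0 => /set1P->; rewrite cycle_id.
exists s; first exact: mem_gen.
by apply: abelian_gen_expg => // t /Sc->; rewrite -(Sc s Ss) cycle_id.
Qed.

(** * Exponents and m-th powers in direct products *)

Section DependentProducts.

Variables (I : finType) (gT : I -> finGroupType) (G : forall i, {group gT i}).

Lemma expg_ffun i (x : {dffun forall i, gT i}) m : (x ^+ m) i = x i ^+ m.
Proof. by elim: m => [|m IHm]; rewrite ?expg0 ?ffunE // !expgS mulg_ffun IHm. Qed.

Lemma mem_dfung1 i (a : gT i) : a \in G i -> dfung1 a \in setXn G.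
Proof.
by move=> Ga; apply/setXnP=> j; rewrite ffunE; case: dfwithP.
Qed.

Lemma exponent_setXn_dvdn m :
  (exponent (setXn G) %| m)%N = [forall i, (exponent (G i) %| m)%N].
Proof.
apply/exponentP/forallP => [Gm i|Gm x /setXnP Gx].
  apply/exponentP=> a Ga.
  have /ffunP/(_ i) := Gm _ (mem_dfung1 Ga).
  by rewrite expg_ffun dfung1_id ffunE.
by apply/ffunP=> i; rewrite expg_ffun ffunE; apply/exponentP: (Gx i).
Qed.

(* If z = y ^+ m generates the m-th powers, then modulo #[a] there are p, q with
   p z_i = m, p z_j = 0, q z_i = 0, q z_j = m; as m divides z_i and z_j, this
   yields m = 0. *)
Lemma setXn_expg_cycle i j (a : gT i) (b : gT j) m :
    i != j -> G i = <[a]>%G -> G j = <[b]>%G -> (#[a] %| #[b])%N ->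
    (exists2 y, y \in setXn G & {in setXn G, forall x, x ^+ m \in <[y ^+ m]>}) ->
  (#[a] %| m)%N.
Proof.
move=> neq_ij Gi Gj dvd_ab [y /setXnP Gy Gm].
have Ga : a \in G i by rewrite Gi cycle_id.
have Gb : b \in G j by rewrite Gj cycle_id.
have /cycleP[p /ffunP Ep] := Gm _ (mem_dfung1 Ga).
have /cycleP[q /ffunP Eq] := Gm _ (mem_dfung1 Gb).
have /cycleP[s ys] : y i \in <[a]> by have := Gy i; rewrite Gi.
have /cycleP[t yt] : y j \in <[b]> by have := Gy j; rewrite Gj.
have := Ep i; have := Ep j; have := Eq j.
rewrite !expg_ffun !dfung1_id dfung1_dflt // expg1n ys yt -!expgM.
move/eqP; rewrite eq_expg_mod_order => /eqP/(congr1 (modn^~ #[a])).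
rewrite !modn_dvdm // => Em.
move/esym/eqP; rewrite -order_dvdn => /(dvdn_trans dvd_ab) dvd_tmp.
move/eqP; rewrite eq_expg_mod_order => /eqP Em'.
(* Modulo [#[a]]: m = t q m = t q (s p m) = q s (t p m) = 0. *)
rewrite /dvdn Em mulnCA mulnC -modnMmr Em' modnMmr -/(dvdn _ _).
suff -> : (t * q * (s * (m * p)) = q * s * (t * (m * p)))%N by exact: dvdn_mull.
by rewrite (mulnC t q) mulnACA.
Qed.

End DependentProducts.

(** * Invariant factors *)

Lemma exponent_Zp n : (0 < n)%N -> exponent (Zp n) = n.
Proof.
move=> n_gt0; suff cycZp : cyclic (Zp n) by rewrite exponent_cyclic ?card_Zp.
by rewrite /Zp; case: ifP => _; rewrite ?Zp_cycle ?cycle_cyclic ?cyclic1.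
Qed.

Lemma sorted_dvdn_nth (s : seq nat) i j :
  sorted dvdn s -> (i <= j < size s)%N -> (nth 0 s i %| nth 0 s j)%N.
Proof.
move=> sorted_s /andP[le_ij lt_js].
apply: sorted_leq_nth => //; [exact: dvdn_trans | exact: leq_ltn_trans lt_js].
Qed.

Lemma invariant_factors_gt0 (Gamma : finZmodType) d i :
  invariant_factors Gamma d -> (i < size d)%N -> (0 < nth 0 d i)%N.
Proof.
case=> -[/all_nthP d_gt1|->] _ _ _ lt_id; last by case: i lt_id.
exact: ltnW (d_gt1 _ _ lt_id).
Qed.

Lemma exponent_invariant_factors (Gamma : finZmodType) d :
  invariant_factors Gamma d -> exponent [set: Gamma] = last 0%N d.
Proof.
move=> dP; have d_gt0 := invariant_factors_gt0 dP; case: dP.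
move=> _ d_neq0 sorted_d isoG.
have lt_last : ((size d).-1 < size d)%N by case: (d) d_neq0.
rewrite (exponent_isog isoG) -nth_last; apply/eqP; rewrite eqn_dvd.
rewrite exponent_setXn_dvdn; apply/andP; split.
  apply/forallP=> i; rewrite /= exponent_Zp ?d_gt0 //.
  apply: sorted_dvdn_nth => //; rewrite lt_last andbT -ltnS prednK //.
  exact: leq_trans (ltn_ord i).
(* Conversely, the exponent of the product is a multiple of that of its last factor. *)
have := dvdnn (exponent (setXn (fun i : 'I_(size d) => Zp (nth 0%N d i)))).
rewrite exponent_setXn_dvdn => /forallP/(_ (Ordinal lt_last)) /=.
by rewrite exponent_Zp // d_gt0.
Qed.

Lemma isog_expg_cycle (aT rT : finGroupType) (G : {group aT}) (H : {group rT}) m :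
    G \isog H -> (exists2 y, y \in G & {in G, forall x, x ^+ m \in <[y ^+ m]>}) ->
  exists2 y, y \in H & {in H, forall x, x ^+ m \in <[y ^+ m]>}.
Proof.
case/isogP=> f injf <- [y Gy Gm]; exists (f y); first exact: mem_morphim.
move=> _ /morphimP[x _ Gx ->]; rewrite -!morphX -?morphim_cycle ?groupX //.
by apply: mem_morphim; [exact: groupX | exact: Gm].
Qed.

(** The two cyclic factors of largest order, at the 0-based indices [size d - 2] and [size d - 1],
    are compared inside the product. *)
Lemma invariant_factor_dvd_expg_cycle (Gamma : finZmodType) d m :
    invariant_factors Gamma d -> (2 <= size d)%N ->
    (exists2 y, y \in [set: Gamma] &
      {in [set: Gamma], forall x, x ^+ m \in <[y ^+ m]>}) ->
  (nth 0 d (size d - 2) %| m)%N.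
Proof.
case=> d_gt1 _ sorted_d isoG le2d cycG.
(* Length at least 2 rules out the list [[:: 1]], so each [Zp] below is all of ['Z_n], generated by
   [Zp1]. *)
have {}d_gt1 i : (i < size d)%N -> (1 < nth 0 d i)%N.
  by case: d_gt1 => [/all_nthP|d1]; [exact | rewrite d1 in le2d].
have lt_i : (size d - 2 < size d)%N by rewrite ltn_subrL (ltnW le2d).
have lt_j : (size d - 1 < size d)%N by rewrite ltn_subrL (ltnW le2d).
have neq_ij : Ordinal lt_i != Ordinal lt_j.
  by rewrite -val_eqE /= ltn_eqF // ltn_sub2l.
have ZpE i : (1 < nth 0 d i)%N -> Zp_group (nth 0 d i) = <[Zp1]>%G.
  by move=> lt1; apply/val_inj; rewrite /= /Zp lt1 Zp_cycle.
have oZp1 i : (1 < nth 0 d i)%N -> #[Zp1 : 'Z_(nth 0 d i)] = nth 0 d i.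
  by move=> lt1; rewrite order_Zp1 Zp_cast.
rewrite -(oZp1 _ (d_gt1 _ lt_i)).
apply: (@setXn_expg_cycle _ _ (fun i : 'I_(size d) => Zp_group (nth 0 d i))
          _ _ _ _ _ neq_ij (ZpE _ (d_gt1 _ lt_i)) (ZpE _ (d_gt1 _ lt_j))).
  by rewrite !oZp1 ?d_gt1 // sorted_dvdn_nth // lt_j andbT leq_sub2l.
exact: isog_expg_cycle isoG cycG.
Qed.

(** * The divisibility conditions *)

Lemma magic_map_affinely_generating_exponent (T : finType) (e : rel T)
    (v k lambda mu : nat) (Gamma : finZmodType) (f : T -> Gamma) :
    strongly_regular e v k lambda mu -> magic_map e f -> affinely_generating f ->
  (exponent [set: Gamma] %| `|k%:Z - mu%:Z|)%N.
Proof.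
move=> srgG magic_f affG; have [c fc] := magic_map_scaled_const srgG magic_f.
apply/exponentP=> x; rewrite -affG => Gx; apply/set1P; move: x Gx.
(* With [K] trivial, it suffices that k - mu kills each difference of labels. *)
apply: (@abelian_gen_expg _ _ 1%G); first by rewrite affG FinRing.zmod_abelian.
move=> _ /imset2P[x y _ _ ->]; apply/set1P.
by rewrite FinRing.zmodXgE mulrnBl !fc subrr.
Qed.

Local Open Scope ring_scope.

Theorem theorem5p11 (T : finType) (e : rel T) (v k lambda mu : nat)
    (srgG : strongly_regular e v k lambda mu) (neq_k_mu : k <> mu)
    (Gamma : finZmodType) (d : seq nat) (dP : invariant_factors Gamma d) :
  [/\ (exists f : T -> Gamma, magic_map e f /\ affinely_generating f) ->
        last 0%N d = exponent [set: Gamma] /\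
        ((exponent [set: Gamma])%:Z %| k%:Z - mu%:Z)%Z,
      (2 <= size d)%N ->
      (exists f : T -> Gamma, magic_map e f /\ generating f) ->
        ((nth 0%N d (size d - 2))%:Z %| k%:Z - mu%:Z)%Z &
      #|Gamma| = v ->
      (exists f : T -> Gamma, distance_magic_labeling e f) ->
        ((exponent [set: Gamma])%:Z %| k%:Z - mu%:Z)%Z].
Proof.
rewrite !dvdzE !absz_nat; split.
- case=> f [magic_f affG]; split.
    by rewrite (exponent_invariant_factors dP).
  exact: magic_map_affinely_generating_exponent srgG magic_f affG.
- move=> le2d [f [magic_f genG]].
  apply: (invariant_factor_dvd_expg_cycle dP le2d).
  have [c fc] := magic_map_scaled_const srgG magic_f.
  rewrite -genG; apply: (@abelian_gen_expg_cycle _ _ _ c).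
    by rewrite genG FinRing.zmod_abelian.
  by move=> _ /imsetP[x _ ->]; exact: fc.
move=> _ [f [[g fK gK] magic_f]].
apply: magic_map_affinely_generating_exponent srgG magic_f _.
apply/setP=> a; rewrite inE mem_gen //.
(* By surjectivity 0 is a label, so [a] is the difference of the labels [a] and 0. *)
by apply/imset2P; exists (g a) (g 0); rewrite ?gK ?subr0.
Qed.
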